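(* Let $r\ge 3$ and let $H$ be a min&max-marked $r$-uniform clique with at least $2r-2$ vertices. Then $H$ has an agreeing linear order if and only if each subhypergraph of $H$ with $2r-2$ vertices has an agreeing linear order.
   Context: All hypergraphs are finite. An $r$-uniform clique is a complete $r$-uniform hypergraph $H$ with no repeated edges, i.e. its edge set $E(H)$ consists of all $r$-element subsets of its vertex set $V(H)$. A min&max-marked $r$-uniform clique is an $r$-uniform clique together with, for each edge $e\in E(H)$, two distinct marked vertices of $e$: a min-vertex $A(e)\in e$ and a max-vertex $B(e)\in e$. The subhypergraph of $H$ on a vertex set $U\subseteq V(H)$ is the one with vertex set $U$ whose edges are all edges $e\in E(H)$ with $e\subseteq U$, with the same marks. A linear order $L$ on the vertex set of a min&max-marked clique is an agreeing linear order if $A(e)<_L v<_L B(e)$ for every edge $e$ and every $v\in e\setminus\{A(e),B(e)\}$. *)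

(* Defs.v *)
From mathcomp Require Import all_boot.
Set Implicit Arguments. Unset Strict Implicit. Unset Printing Implicit Defensive.

(* The vertex set is an arbitrary finite set of elements of T, not all of T, so
   that subhypergraphs live in the same type.  Marks are total functions on
   {set T}; only their values on edges are ever constrained or used. *)
Record marked_hypergraph (T : finType) := MarkedHypergraph {
  vertices : {set T};
  edges : {set {set T}};
  min_vertex : {set T} -> T;
  max_vertex : {set T} -> T
}.

Definition marked_clique (T : finType) (r : nat) (H : marked_hypergraph T) : Prop :=
  edges H = [set e : {set T} | (e \subset vertices H) && (#|e| == r)] /\
  forall e, e \in edges H ->
    [/\ min_vertex H e \in e, max_vertex H e \in e
      & min_vertex H e != max_vertex H e].

Definition subhypergraph (T : finType) (H : marked_hypergraph T) (U : {set T}) :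
    marked_hypergraph T :=
  MarkedHypergraph U [set e in edges H | e \subset U]
    (min_vertex H) (max_vertex H).

(* Non-strict orders; the values of L outside V are irrelevant. *)
Definition linear_order_on (T : finType) (V : {set T}) (L : rel T) : Prop :=
  [/\ {in V, reflexive L}, {in V &, antisymmetric L},
      {in V & &, transitive L} & {in V &, total L}].

Definition strict_part (T : finType) (L : rel T) : rel T :=
  fun x y => (x != y) && L x y.

Definition agreeing_linear_order (T : finType) (H : marked_hypergraph T)
    (L : rel T) : Prop :=
  linear_order_on (vertices H) L /\
  forall e, e \in edges H ->
  forall v, v \in e :\: [set min_vertex H e; max_vertex H e] ->
    strict_part L (min_vertex H e) v /\ strict_part L v (max_vertex H e).

Definition has_agreeing_linear_order (T : finType) (H : marked_hypergraph T) : Prop :=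
  exists L : rel T, agreeing_linear_order H L.

Lemma subhypergraph_clique (T : finType) (r : nat) (H : marked_hypergraph T)
    (U : {set T}) :
  marked_clique r H -> U \subset vertices H -> marked_clique r (subhypergraph H U).
Proof.
move=> [defE markE] sUV; split=> [|e] /=; last by rewrite inE => /andP[/markE].
apply/setP=> e; rewrite defE !inE andbC.
case sU: (e \subset U) => //=.
by rewrite (subset_trans sU sUV).
Qed.

(* Main.v *)
Require Import Defs.
From mathcomp Require Import all_boot zify.

(** The marks of an edge [e] force [x < y] in every agreeing order exactly when
    [x <> y] lie in [e] and [x] is its min-vertex or [y] its max-vertex; call
    this an arc from [x] to [y].  An agreeing order is then a linear order that
    contains all arcs, so the only candidate, when every pair of vertices is
    joined by an arc, is the arc relation itself.

    On a clique with at least [2r - 3] vertices that has an agreeing order,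
    every pair is joined ([strict_part_arc]): if [x < y], the vertices at or
    above [x] and those at or below [y] cover everything and share [x] and
    [y], so one of the two sets has at least [r] elements, and it contains an
    edge through [x] and [y] whose min-vertex is [x], or whose max-vertex is
    [y].

    Suppose that all subhypergraphs on [2r - 2] vertices have agreeing orders.
    Two edges with two common vertices have at most [2r - 2] vertices together,
    so opposite arcs would already contradict each other in one of these
    subhypergraphs: arcs are asymmetric ([arc_asym]).  Any three vertices also
    fit into one of them, and there the arcs form a linear order, with which all
    arcs between these vertices agree ([arc_local]).  Hence the arcs are total
    and transitive on the whole vertex set.  Asymmetry is the step that uses
    [2r - 2] vertices and not just [2r - 3]. *)

Set Implicit Arguments. Unset Strict Implicit. Unset Printing Implicit Defensive.

(** * Intermediate sets and restriction of orders *)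

Lemma exists_set_between (T : finType) (A B : {set T}) (k : nat) :
  A \subset B -> #|A| <= k <= #|B| ->
  exists C : {set T}, [/\ A \subset C, C \subset B & #|C| = k].
Proof.
move=> sAB /andP[]; elim: k => [|k IHk] leAk lekB.
  by exists A; split=> //; lia.
have [eqAk | neAk] := eqVneq #|A| k.+1; first by exists A.
have [||C [sAC sCB cardC]] := IHk; [lia | lia |].
have /properP[_ [z zB zC]] : C \proper B by rewrite properEcard sCB cardC.
exists (z |: C); rewrite cardsU1 zC cardC; split=> //.
  exact: subset_trans sAC (subsetUr _ _).
by rewrite subUset sub1set zB.
Qed.

Lemma linear_order_onS (T : finType) (U V : {set T}) (L : rel T) :
  U \subset V -> linear_order_on V L -> linear_order_on U L.
Proof.
move=> /subsetP sUV [Lxx Lanti Ltr Ltot]; split.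
- by move=> x /sUV; apply: Lxx.
- by move=> x y /sUV xV /sUV; apply: Lanti.
- by move=> y x z /sUV yV /sUV xV /sUV; apply: Ltr.
- by move=> x y /sUV xV /sUV; apply: Ltot.
Qed.

Lemma agreeing_subhypergraph (T : finType) (H : marked_hypergraph T)
    (U : {set T}) (L : rel T) :
  U \subset vertices H -> agreeing_linear_order H L ->
  agreeing_linear_order (subhypergraph H U) L.
Proof.
move=> sUV [ordL LH]; split; first exact: linear_order_onS sUV ordL.
by move=> e; rewrite inE => /andP[/LH].
Qed.

(** * Arcs and strict inequality in an agreeing order *)

Definition edge_arc (T : finType) (H : marked_hypergraph T) (e : {set T}) : rel T :=
  fun x y => [&& x \in e, y \in e, x != y &
    (x == min_vertex H e) || (y == max_vertex H e)].

Definition arc (T : finType) (H : marked_hypergraph T) : rel T :=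
  fun x y => [exists e in edges H, edge_arc H e x y].

Section AgreeingOrder.

Variables (T : finType) (r : nat) (H : marked_hypergraph T) (L : rel T).
Hypotheses (hr : 3 <= r) (hH : marked_clique r H).
Hypothesis hL : agreeing_linear_order H L.

Lemma strict_part_asym x y :
  x \in vertices H -> y \in vertices H -> strict_part L x y -> ~~ L y x.
Proof.
have [[_ Lanti _ _] _] := hL => xV yV /andP[nexy Lxy].
by apply: contraNN nexy => Lyx; apply/eqP/Lanti; rewrite ?Lxy.
Qed.

Lemma strict_part_trans y x z :
  y \in vertices H -> x \in vertices H -> z \in vertices H ->
  strict_part L x y -> strict_part L y z -> strict_part L x z.
Proof.
have [[_ _ Ltr _] _] := hL => yV xV zV ltxy /andP[_ Lyz].
apply/andP; split; last by case/andP: ltxy => _ /(Ltr y x z); apply.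
by apply: contraTneq Lyz => <-; apply: strict_part_asym.
Qed.

Lemma edgeP e : e \in edges H -> e \subset vertices H /\ #|e| = r.
Proof. by have [-> _] := hH; rewrite inE => /andP[? /eqP]. Qed.

(** The definition of agreement compares the two marks only through a third
    vertex, which exists because [r >= 3]. *)
Lemma strict_part_marks e : e \in edges H ->
  strict_part L (min_vertex H e) (max_vertex H e).
Proof.
move=> eE; have [/subsetP sV cardE] := edgeP eE; have [_ LH] := hL.
have [_ /(_ e eE)[Ae Be _]] := hH.
have [v vD] : exists v, v \in e :\: [set min_vertex H e; max_vertex H e].
  apply/set0Pn; rewrite -card_gt0 cardsD.
  have := subset_leq_card (subsetIr e [set min_vertex H e; max_vertex H e]).
  by rewrite cards2; lia.
have [ltAv ltvB] := LH e eE v vD; move: vD; rewrite inE => /andP[_ ve].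
by apply: (strict_part_trans (y := v)) => //; apply: sV.
Qed.

Lemma strict_part_min e v : e \in edges H -> v \in e -> v != min_vertex H e ->
  strict_part L (min_vertex H e) v.
Proof.
move=> eE ve neA; have [_ LH] := hL.
have [-> | neB] := eqVneq v (max_vertex H e); first exact: strict_part_marks.
by apply: (LH e eE v _).1; rewrite !inE negb_or neA neB.
Qed.

Lemma strict_part_max e v : e \in edges H -> v \in e -> v != max_vertex H e ->
  strict_part L v (max_vertex H e).
Proof.
move=> eE ve neB; have [_ LH] := hL.
have [-> | neA] := eqVneq v (min_vertex H e); first exact: strict_part_marks.
by apply: (LH e eE v _).2; rewrite !inE negb_or neA neB.
Qed.

Lemma arc_strict_part x y : arc H x y -> strict_part L x y.
Proof.
case/exists_inP=> e eE /and4P[xe ye nexy /orP[]/eqP eq_mark].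
  by rewrite eq_mark; apply: strict_part_min; rewrite // -eq_mark eq_sym.
by rewrite eq_mark; apply: strict_part_max; rewrite // -eq_mark.
Qed.

(** The up-set of [x] and the down-set of [y] cover all vertices and overlap in
    at least two, so their sizes add up to at least [2r - 1]; an edge inside
    the one of size at least [r] has the desired mark at [x] or at [y]. *)
Lemma strict_part_arc x y : 2 * r - 3 <= #|vertices H| ->
  x \in vertices H -> y \in vertices H -> strict_part L x y -> arc H x y.
Proof.
move=> leV xV yV ltxy; have [nexy Lxy] := andP ltxy.
have [[Lxx _ Ltr Ltot] _] := hL.
pose up := [set z in vertices H | L x z].
pose down := [set z in vertices H | L z y].
have xy_up : [set x; y] \subset up.
  by rewrite subUset !sub1set !inE xV yV Lxy Lxx.
have xy_down : [set x; y] \subset down.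
  by rewrite subUset !sub1set !inE xV yV Lxy Lxx.
have cover : vertices H \subset up :|: down.
  apply/subsetP=> z zV; rewrite !inE zV /=.
  by case/orP: (Ltot x z xV zV) => [-> // | Lzx]; rewrite (Ltr x z y) ?orbT.
have card_xy : #|[set x; y]| = 2 by rewrite cards2 nexy.
have sum_card : 2 * r - 1 <= #|up| + #|down|.
  have := subset_leq_card cover; rewrite cardsU.
  have : [set x; y] \subset up :&: down by rewrite subsetI xy_up.
  by move/subset_leq_card; rewrite card_xy; lia.
have edge_in (S : {set T}) : [set x; y] \subset S -> S \subset vertices H ->
    r <= #|S| -> exists2 e, e \in edges H & [/\ x \in e, y \in e & e \subset S].
  move=> xyS SV leS; have [|e [xye eS carde]] := exists_set_between (k := r) xyS.
    by rewrite card_xy; lia.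
  exists e; first by have [-> _] := hH; rewrite inE (subset_trans eS SV) carde /=.
  by move: xye; rewrite subUset !sub1set => /andP[].
have [_ marks] := hH.
have [le_up | lt_up] := leqP r #|up|.
  have [|//|e eE [xe ye /subsetP eS]] := edge_in up xy_up.
    by apply/subsetP=> z; rewrite inE => /andP[].
  apply/exists_inP; exists e => //; rewrite /edge_arc xe ye nexy /=.
  have [Ae _ _] := marks e eE; move: (eS _ Ae); rewrite inE => /andP[AV LxA].
  apply/orP; left; apply/contraLR: LxA => neA.
  by apply: strict_part_asym => //; apply: strict_part_min.
have [||e eE [xe ye /subsetP eS]] := edge_in down xy_down; last 1 first.
- apply/exists_inP; exists e => //; rewrite /edge_arc xe ye nexy /=.
  have [_ Be _] := marks e eE; move: (eS _ Be); rewrite inE => /andP[BV LBy].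
  apply/orP; right; apply/contraLR: LBy => neB.
  by apply: strict_part_asym => //; apply: strict_part_max.
- by apply/subsetP=> z; rewrite inE => /andP[].
- by lia.
Qed.

End AgreeingOrder.

Lemma arc_subhypergraph (T : finType) (H : marked_hypergraph T) (U : {set T}) x y :
  arc (subhypergraph H U) x y -> arc H x y.
Proof.
case/exists_inP=> e; rewrite inE => /andP[eE _] arc_e.
by apply/exists_inP; exists e.
Qed.

(** * From local orders to a global order *)

Section LocallyOrderable.

Variables (T : finType) (r : nat) (H : marked_hypergraph T).
Hypotheses (hr : 3 <= r) (hH : marked_clique r H).
Hypothesis hV : 2 * r - 2 <= #|vertices H|.
Hypothesis local_order : forall U : {set T},
  U \subset vertices H -> #|U| = 2 * r - 2 ->
  has_agreeing_linear_order (subhypergraph H U).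

Lemma local_order_around (W : {set T}) :
  W \subset vertices H -> #|W| <= 2 * r - 2 ->
  exists U : {set T}, [/\ W \subset U, U \subset vertices H, #|U| = 2 * r - 2
    & has_agreeing_linear_order (subhypergraph H U)].
Proof.
move=> WV leW; have [|U [WU UV cardU]] := exists_set_between (k := 2 * r - 2) WV.
  by rewrite leW.
by exists U; split=> //; apply: local_order.
Qed.

Lemma arc_asym x y : arc H x y -> ~~ arc H y x.
Proof.
case/exists_inP=> e eE arc_e; apply/negP=> /exists_inP[f fE arc_f].
have [eV carde] := edgeP hH eE; have [fV cardf] := edgeP hH fE.
have [xe ye nexy _] := and4P arc_e; have [yf xf _ _] := and4P arc_f.
have le_ef : #|e :|: f| <= 2 * r - 2.
  have : [set x; y] \subset e :&: f by rewrite subUset !sub1set !inE xe xf ye yf.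
  by move/subset_leq_card; rewrite cards2 nexy cardsU carde cardf; lia.
have [|U [efU UV _ [L agL]]] := local_order_around _ le_ef.
  by rewrite subUset eV.
have [eU fU] := andP (etrans (esym (subUset _ _ _)) efU).
have ltxy : strict_part L x y.
  apply: (arc_strict_part hr (subhypergraph_clique hH UV) agL).
  by apply/exists_inP; exists e; rewrite // inE eE.
have /andP[_ Lyx] : strict_part L y x.
  apply: (arc_strict_part hr (subhypergraph_clique hH UV) agL).
  by apply/exists_inP; exists f; rewrite // inE fE.
have := strict_part_asym agL (subsetP eU x xe) (subsetP eU y ye) ltxy.
by rewrite Lyx.
Qed.

(** A local order is contained in the arcs, and asymmetry of the arcs turns
    this inclusion into equality: arcs from edges that leave the [2r - 2]
    chosen vertices cannot disagree with it. *)
Lemma arc_local (W : {set T}) : W \subset vertices H -> #|W| <= 3 ->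
  exists2 L : rel T, linear_order_on W L
    & {in W &, forall x y, arc H x y = strict_part L x y}.
Proof.
move=> WV leW; have [|U [WU UV cardU [L agL]]] := local_order_around WV.
  by lia.
have arcL : {in U &, forall x y, strict_part L x y -> arc H x y}.
  move=> x y xU yU ltxy; apply: (arc_subhypergraph (U := U)).
  apply: (strict_part_arc hr (subhypergraph_clique hH UV) agL) => //=.
  by rewrite cardU; lia.
exists L => [|x y /(subsetP WU) xU /(subsetP WU) yU].
  by apply: linear_order_onS WU _; case: agL.
apply/idP/idP=> [arcxy|]; last exact: arcL.
have nexy : x != y by case/exists_inP: arcxy => e _ /and4P[].
rewrite /strict_part nexy /=; have [[_ _ _ Ltot] _] := agL.
case/orP: (Ltot x y xU yU) => // Lyx.
have /negP[] := arc_asym arcxy; apply: arcL => //.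
by rewrite /strict_part eq_sym nexy.
Qed.

Lemma arc_linear_order :
  linear_order_on (vertices H) (fun x y => (x == y) || arc H x y).
Proof.
split=> [x _ | x y _ _ | y x z yV xV zV | x y xV yV] /=; first by rewrite eqxx.
- case/andP=> /orP[/eqP // | /arc_asym/negPf arcyx].
  by rewrite arcyx orbF => /eqP.
- case/orP=> [/eqP -> // | arcxy] /orP[/eqP <- | arcyz]; first by rewrite arcxy orbT.
  have [|| L [_ _ Ltr _] arcL] := @arc_local [set x; y; z].
  + by rewrite !subUset !sub1set xV yV zV.
  + by rewrite setUC cardsU1 cards2; case: (z \in _); case: (x == y).
  have [xW yW zW] : [/\ x \in [set x; y; z], y \in [set x; y; z]
      & z \in [set x; y; z]] by rewrite !inE !eqxx !orbT.
  have [// | nexz] := eqVneq x z; rewrite arcL // /strict_part nexz /=.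
  move: arcxy arcyz; rewrite !arcL // => /andP[_ Lxy] /andP[_ Lyz].
  exact: Ltr Lxy Lyz.
have [|| L [_ _ _ Ltot] arcL] := @arc_local [set x; y].
- by rewrite subUset !sub1set xV yV.
- by rewrite cards2; case: (x != y).
have [// | nexy] := eqVneq x y.
rewrite !arcL ?set21 ?set22 // /strict_part (eq_sym y) nexy /=.
by rewrite Ltot ?set21 ?set22.
Qed.

Lemma arc_agreeing_linear_order :
  agreeing_linear_order H (fun x y => (x == y) || arc H x y).
Proof.
split=> [|e eE v]; first exact: arc_linear_order.
have [_ /(_ e eE)[Ae Be _]] := hH.
rewrite !inE negb_or => /andP[/andP[neA neB] ve].
split; apply/andP; split; rewrite // 1?eq_sym //; apply/orP; right;
  apply/exists_inP; exists e => //; rewrite /edge_arc ?Ae ?Be ve eqxx ?orbT ?andbT //.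
by rewrite eq_sym.
Qed.

End LocallyOrderable.

Theorem theorem3 (T : finType) (r : nat) (H : marked_hypergraph T)
    (hr : 3 <= r) (hH : marked_clique r H) (hV : 2 * r - 2 <= #|vertices H|) :
  has_agreeing_linear_order H <->
  (forall U : {set T}, U \subset vertices H -> #|U| = 2 * r - 2 ->
     has_agreeing_linear_order (subhypergraph H U)).
Proof.
split=> [[L agL] U UV _ | local_order].
  by exists L; apply: agreeing_subhypergraph.
by eexists; apply: arc_agreeing_linear_order local_order.
Qed.
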